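(* For every $w\in\mathbb NQ_0$, the module $\tilde q^w=\bigcup_{\sigma\in\mathcal W}q^{w,\sigma}$ is an injective hull of $s^w$ in the category $\mathcal P$-lnMod of locally nilpotent $\mathcal P$-modules.
   Context: Let $Q=(Q_0,Q_1)$ be a finite quiver without loops; $\tilde Q$ its double quiver (each arrow $a$ gets an opposite arrow $\bar a$), and $\mathcal P=\mathbb C\tilde Q/\big(\sum_{a\in Q_1}(a\bar a-\bar a a)\big)$ the preprojective algebra, graded by path length, $\mathcal P=\bigoplus_{n\ge0}\mathcal P_n$. A $\mathcal P$-module $M$ is locally nilpotent if for each $m\in M$ there is $n$ with $\mathcal P_nm=0$. For $i\in Q_0$, $s^i$ is the one-dimensional $\mathcal P$-module at vertex $i$ with arrows acting by $0$; $s^w=\bigoplus_i(s^i)^{\oplus w_i}$; $q^i$ is an injective hull of $s^i$ in the category of all $\mathcal P$-modules and $q^w=\bigoplus_i(q^i)^{\oplus w_i}$. Let $\mathfrak g$ be the symmetric Kac–Moody algebra whose Dynkin diagram is the underlying graph of $Q$, with fundamental weights $\omega_i$, simple roots $\alpha_i$, Weyl group $\mathcal W$ and Bruhat order $\preceq$. For $u\in\mathbb ZQ_0$ put $\omega_u=\sum u_i\omega_i$, $\alpha_u=\sum u_i\alpha_i$; $\sigma\cdot_wv$ is the unique $u$ with $\sigma(\omega_w-\alpha_v)=\omega_w-\alpha_u$. For $\sigma\in\mathcal W$, $q^w$ has a unique $\mathcal P$-submodule of graded dimension $\sigma\cdot_w0$, denoted $q^{w,\sigma}$; these satisfy $q^{w,\sigma_1}\subseteq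 q^{w,\sigma_2}$ whenever $\sigma_1\preceq\sigma_2$, so they form a directed system whose union (direct limit) is $\tilde q^w$. *)

(* Defs.v *)
From HB Require Import structures.
From mathcomp Require Import all_boot all_order all_algebra.
Set Implicit Arguments. Unset Strict Implicit. Unset Printing Implicit Defensive.
Import Order.TTheory GRing.Theory Num.Theory.
Local Open Scope ring_scope.

Section Preproj.
Variables (K : fieldType) (n : nat) (A : finType) (src tgt : A -> 'I_n).

(* arrows of the double quiver: inl a = a, inr a = abar *)
Definition darr := (A + A)%type.
Definition dsrc (d : darr) : 'I_n := match d with inl a => src a | inr a => tgt a end.
Definition dtgt (d : darr) : 'I_n := match d with inl a => tgt a | inr a => src a end.

(* A P-module structure on a K-vector space M: the actions of the generators
   e_i (trivial paths) and of the arrows of the double quiver. *)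
Record pmod_ops (M : lmodType K) := PModOps {
  pe : 'I_n -> M -> M;
  px : darr -> M -> M }.

Definition is_linear (M N : lmodType K) (f : M -> N) : Prop :=
  forall (a : K) (u v : M), f (a *: u + v) = a *: f u + f v.

Definition is_pmod (M : lmodType K) (p : pmod_ops M) : Prop :=
  [/\ (forall i, is_linear (pe p i)) /\ (forall d, is_linear (px p d)),
      (forall i j m, pe p i (pe p j m) = if i == j then pe p i m else 0),
      (forall m, \sum_(i < n) pe p i m = m),
      (forall d m, px p d m = pe p (dtgt d) (px p d (pe p (dsrc d) m))) &
      (forall m, \sum_(a : A) (px p (inl a) (px p (inr a) m)
                              - px p (inr a) (px p (inl a) m)) = 0)].

Definition is_hom (M N : lmodType K) (pM : pmod_ops M) (pN : pmod_ops N)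
    (f : M -> N) : Prop :=
  [/\ is_linear f,
      (forall i m, f (pe pM i m) = pe pN i (f m)) &
      (forall d m, f (px pM d m) = px pN d (f m))].

Definition is_submodule (M : lmodType K) (p : pmod_ops M) (S : M -> Prop) : Prop :=
  [/\ S 0,
      (forall (a : K) u v, S u -> S v -> S (a *: u + v)),
      (forall i m, S m -> S (pe p i m)) &
      (forall d m, S m -> S (px p d m))].

Definition killed_by_paths (M : lmodType K) (p : pmod_ops M) (N : nat) (m : M) : Prop :=
  forall ds : seq darr, size ds = N -> foldr (fun d v => px p d v) m ds = 0.

Definition loc_nilp_sub (M : lmodType K) (p : pmod_ops M) (S : M -> Prop) : Prop :=
  forall m, S m -> exists N, killed_by_paths p N m.

Definition loc_nilp (M : lmodType K) (p : pmod_ops M) : Prop :=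
  loc_nilp_sub p (fun _ => True).

Definition catMod (X : lmodType K) (p : pmod_ops X) : Prop := is_pmod p.
Definition catLn (X : lmodType K) (p : pmod_ops X) : Prop := is_pmod p /\ loc_nilp p.

(* the submodule S of M (viewed as a module) is an injective object of the
   category C: morphisms into S are morphisms into M with image in S *)
Definition injective_in (C : forall X : lmodType K, pmod_ops X -> Prop)
    (M : lmodType K) (pM : pmod_ops M) (S : M -> Prop) : Prop :=
  forall (X Y : lmodType K) (pX : pmod_ops X) (pY : pmod_ops Y) (f : X -> Y) (g : X -> M),
    C X pX -> C Y pY -> is_hom pX pY f -> injective f ->
    is_hom pX pM g -> (forall x, S (g x)) ->
    exists h : Y -> M, [/\ is_hom pY pM h, (forall y, S (h y)) & (forall x, h (f x) = g x)].

Definition essential_in (M T : lmodType K) (pM : pmod_ops M) (S : M -> Prop)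
    (j : T -> M) : Prop :=
  forall U : M -> Prop, is_submodule pM U -> (forall m, U m -> S m) ->
    (exists m, U m /\ m <> 0) -> exists t, U (j t) /\ j t <> 0.

(* the semisimple module s^w: basis indexed by pairs (i,k), k < w i,
   the basis vector (i,k) lying at vertex i, arrows acting by 0 *)
Definition sidx (w : 'I_n -> nat) :=
  {x : 'I_n * 'I_(\sum_(i < n) w i).+1 | (x.2 < w x.1)%N}.
Definition SW (w : 'I_n -> nat) : lmodType K := {ffun sidx w -> K^o}.
Definition sw_ops (w : 'I_n -> nat) : pmod_ops (SW w) :=
  PModOps (fun i (f : SW w) => [ffun x => if (val x).1 == i then f x else 0])
          (fun _ _ => 0).

Definition injective_hull_in (C : forall X : lmodType K, pmod_ops X -> Prop)
    (M T : lmodType K) (pM : pmod_ops M) (pT : pmod_ops T) (S : M -> Prop)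
    (j : T -> M) : Prop :=
  [/\ is_submodule pM S /\ (forall t, S (j t)),
      is_hom pT pM j,
      injective j,
      injective_in C pM S &
      essential_in pM S j].

Definition gdim (M : lmodType K) (p : pmod_ops M) (S : M -> Prop) (u : 'I_n -> int) : Prop :=
  forall i, exists (d : nat) (b : 'I_d -> M),
    [/\ u i = d%:Z,
        (forall k, S (b k) /\ pe p i (b k) = b k),
        (forall c : 'I_d -> K, \sum_(k < d) c k *: b k = 0 -> forall k, c k = 0) &
        (forall m, S m -> pe p i m = m -> exists c : 'I_d -> K, m = \sum_(k < d) c k *: b k)].

Definition cartan (i j : 'I_n) : int :=
  if i == j then 2
  else - (#|[pred a : A | (src a == i) && (tgt a == j)]|
          + #|[pred a : A | (src a == j) && (tgt a == i)]|)%:Z.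

(* s_i .w v : s_i(omega_w - alpha_v) = omega_w - alpha_u, where
   s_i(lambda) = lambda - <alpha_i^vee, lambda> alpha_i *)
Definition sref_dot (w : 'I_n -> nat) (i : 'I_n) (v : 'I_n -> int) : 'I_n -> int :=
  fun j => if j == i then v i + (w i)%:Z - \sum_(k < n) cartan i k * v k else v j.

(* sigma = s_{i1} ... s_{ik} given as the word [:: i1; ...; ik] *)
Definition wdot (w : 'I_n -> nat) (sigma : seq 'I_n) (v : 'I_n -> int) : 'I_n -> int :=
  foldr (sref_dot w) v sigma.

(* q~^w = union over sigma in W of the submodules q^{w,sigma} of Q of graded
   dimension sigma .w 0 *)
Definition qtilde (Q : lmodType K) (pQ : pmod_ops Q) (w : 'I_n -> nat) (m : Q) : Prop :=
  exists (sigma : seq 'I_n) (S : Q -> Prop),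
    [/\ is_submodule pQ S, gdim pQ S (wdot w sigma (fun _ => 0)) & S m].

End Preproj.

(* Main.v *)
Require Import Defs.
From HB Require Import structures.
From mathcomp Require Import all_boot all_order all_algebra.
From mathcomp Require Import zify ring.
From Stdlib Require Import Classical.
Set Implicit Arguments. Unset Strict Implicit. Unset Printing Implicit Defensive.
Import Order.TTheory GRing.Theory Num.Theory.
Local Open Scope ring_scope.

(* The locally nilpotent elements of q^w form an injective hull of s^w among
   locally nilpotent modules, because homomorphic images of locally nilpotent
   modules are locally nilpotent; so the point is that they coincide with the
   union of the submodules of graded dimension sigma ._w 0.

   Fix a vertex i and a finite-dimensional submodule S of q^w of graded dimension
   v.  Injectivity of q^w makes the complex q_i -> (+)_(i -> j) q_j -> q_i exact in
   the middle, and its kernel on the left is the socle, of dimension w_i.  Hence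
   the largest and the smallest submodules agreeing with S away from i have
   dimensions at i adding up to v_i + (s_i ._w v)_i.  Every subspace in between is
   allowed, so the set of graded dimensions of submodules is stable under s_i.

   If sigma ._w 0 + u is such a graded dimension and u pairs nonpositively with
   omega_w - alpha_(sigma ._w 0), then sigma^-1 yields a submodule of graded
   dimension u' = sigma^-1 u >= 0 with u' zero on the support of w; such a
   submodule has no socle, so u = 0.  Therefore, over an orbit point, the largest
   submodule has dimension max(v_i, (s_i ._w v)_i) at i: it is again of orbit
   dimension, and so is the smallest one.  Adjoining tops repeatedly to 0 reaches
   every locally nilpotent element, and descending along a word shows that every
   submodule of orbit dimension is nilpotent. *)

(** * Finite-dimensional subspaces *)

Section Linear.
Variables (K : fieldType) (M N : lmodType K) (f : M -> N).
Hypothesis lf : is_linear f.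

Lemma is_linearD u v : f (u + v) = f u + f v.
Proof. by have := lf 1 u v; rewrite !scale1r. Qed.

Lemma is_linear0 : f 0 = 0.
Proof. by apply: (addrI (f 0)); rewrite -is_linearD !addr0. Qed.

Lemma is_linearZ a u : f (a *: u) = a *: f u.
Proof. by have := lf a u 0; rewrite is_linear0 !addr0. Qed.

Lemma is_linearN u : f (- u) = - f u.
Proof. by rewrite -scaleN1r is_linearZ scaleN1r. Qed.

Lemma is_linearB u v : f (u - v) = f u - f v.
Proof. by rewrite is_linearD is_linearN. Qed.

Lemma is_linear_sum (I : finType) (P : pred I) (F : I -> M) :
  f (\sum_(i | P i) F i) = \sum_(i | P i) f (F i).
Proof. by apply: (big_morph f); [exact: is_linearD | exact: is_linear0]. Qed.

End Linear.

Lemma is_linear_row (K : fieldType) (M : lmodType K) (d : nat) (f : 'rV[K]_d -> M) :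
  is_linear f -> forall u, f u = \sum_j u 0 j *: f (delta_mx 0 j).
Proof.
move=> lf u; rewrite {1}(row_sum_delta u) (is_linear_sum lf).
by apply: eq_bigr => j _; rewrite (is_linearZ lf).
Qed.


Section FinDim.
Variable K : fieldType.
Implicit Types M N : lmodType K.

Definition is_subspace M (S : M -> Prop) : Prop :=
  S 0 /\ (forall (a : K) u v, S u -> S v -> S (a *: u + v)).

(** Encoded by a parametrisation because [M] need not be finite-dimensional and [S] is only a
    predicate; row vectors give access to matrix ranks. *)
Definition fdim M (S : M -> Prop) (d : nat) : Prop :=
  exists f : 'rV[K]_d -> M,
    [/\ is_linear f, (forall u, f u = 0 -> u = 0) & forall m, S m <-> exists u, m = f u].

Lemma fdim_ext M (S T : M -> Prop) d : (forall m, S m <-> T m) -> fdim S d -> fdim T d.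
Proof.
move=> ST [f [lf f0 fS]]; exists f; split=> // m.
by split=> [/ST/fS | /fS/ST].
Qed.

Lemma fdim_subspace M (S : M -> Prop) d : fdim S d -> is_subspace S.
Proof.
move=> [f [lf f0 fS]]; split; first by apply/fS; exists 0; rewrite (is_linear0 lf).
by move=> a u v /fS[x ->] /fS[y ->]; apply/fS; exists (a *: x + y); rewrite lf.
Qed.

Lemma fdim_zero M : fdim (fun m : M => m = 0) 0.
Proof.
exists (fun _ => 0); split=> [a u v | u _ | m].
- by rewrite scaler0 addr0.
- by apply/rowP => -[].
- by split=> [-> | [u ->]] //; exists 0.
Qed.

Lemma lin_comb_linear M d (b : 'I_d -> M) :
  is_linear (fun u : 'rV[K]_d => \sum_k u 0 k *: b k).
Proof.
move=> a u v; rewrite scaler_sumr -big_split; apply: eq_bigr => i _ /=.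
by rewrite !mxE scalerDl scalerA.
Qed.

(** The bridge to [gdim], which counts dimensions by bases. *)
Lemma fdim_basisP M (S : M -> Prop) d : is_subspace S ->
  fdim S d <-> exists b : 'I_d -> M,
    [/\ (forall k, S (b k)),
        (forall c : 'I_d -> K, \sum_(k < d) c k *: b k = 0 -> forall k, c k = 0) &
        (forall m, S m -> exists c : 'I_d -> K, m = \sum_(k < d) c k *: b k)].
Proof.
move=> [S0 SD]; split=> [[f [lf f0 fS]] | [b [Sb b0 bS]]].
- exists (fun k => f (delta_mx 0 k)); split=> [k | c c0 k | m /fS[u ->]].
  + by apply/fS; exists (delta_mx 0 k).
  + have := f0 (\row_j c j); rewrite (is_linear_row lf).
    under eq_bigr do rewrite mxE.
    by move=> /(_ c0)/rowP/(_ k); rewrite !mxE.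
  + by exists (fun k => u 0 k); rewrite -(is_linear_row lf).
- exists (fun u => \sum_k u 0 k *: b k); split; first exact: lin_comb_linear.
  + by move=> u /b0 u0; apply/rowP => j; rewrite mxE u0.
  + move=> m; split=> [/bS[c ->] | [u ->]].
      by exists (\row_j c j); apply: eq_bigr => j _; rewrite mxE.
    by elim/big_rec: _ => // i x _ Sx; apply: SD.
Qed.

(** Expressing each [f (delta_mx 0 i)] through [g] gives a matrix [X] with [f u = g (u *m X)].
    Injectivity of [f] makes [X] row free, so it has at most as many rows as columns. *)
Lemma free_family_le M s t (f : 'rV[K]_s -> M) (g : 'rV[K]_t -> M) :
  is_linear f -> is_linear g -> (forall u, f u = 0 -> u = 0) ->
  (forall u, exists v, f u = g v) -> (s <= t)%N.
Proof.
move=> lf lg f0 fg.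
have [r Hr] := fin_all_exists (fun i => fg (delta_mx 0 i)).
pose X : 'M_(s, t) := \matrix_i r i.
have fX u : f u = g (u *m X).
  rewrite (is_linear_row lf) mulmx_sum_row (is_linear_sum lg).
  by apply: eq_bigr => j _; rewrite (is_linearZ lg) rowK Hr.
have: row_free X.
  rewrite -kermx_eq0; apply/eqP/row_matrixP => i; rewrite row0; apply: f0.
  by rewrite fX -row_mul mulmx_ker row0 (is_linear0 lg).
by rewrite /row_free => /eqP <-; exact: rank_leq_col.
Qed.

Lemma fdim_le M (S T : M -> Prop) s t :
  fdim S s -> fdim T t -> (forall m, S m -> T m) -> (s <= t)%N.
Proof.
move=> [f [lf f0 fS]] [g [lg g0 gT]] ST; apply: (free_family_le lf lg f0) => u.
by apply/gT/ST/fS; exists u.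
Qed.

Lemma fdim_uniq M (S : M -> Prop) s t : fdim S s -> fdim S t -> s = t.
Proof. by move=> Ss St; apply/eqP; rewrite eqn_leq !(fdim_le Ss St, fdim_le St Ss). Qed.

Lemma is_linear_join M s r (f : 'rV[K]_s -> M) (g : 'rV[K]_r -> M) :
  is_linear f -> is_linear g -> is_linear (fun u => f (lsubmx u) + g (rsubmx u)).
Proof. by move=> lf lg a u v; rewrite !linearP lf lg scalerDr addrACA. Qed.

Lemma fdim_join M (S : M -> Prop) s r (f : 'rV[K]_s -> M) (g : 'rV[K]_r -> M) :
  is_linear f -> is_linear g ->
  (forall u v, f u + g v = 0 -> u = 0 /\ v = 0) ->
  (forall m, S m <-> exists u v, m = f u + g v) -> fdim S (s + r).
Proof.
move=> lf lg fg0 fgS; exists (fun u => f (lsubmx u) + g (rsubmx u)); split.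
- exact: is_linear_join lf lg.
- by move=> u /fg0[l0 r0]; rewrite -(hsubmxK u) l0 r0 row_mx0.
- move=> m; split=> [/fgS[u [v ->]] | [u ->]].
    by exists (row_mx u v); rewrite row_mxKl row_mxKr.
  by apply/fgS; exists (lsubmx u), (rsubmx u).
Qed.

Lemma extend_one M s (f : 'rV[K]_s -> M) m : is_linear f ->
  (forall u, f u = 0 -> u = 0) -> ~ (exists u, m = f u) ->
  forall u (c : K), f u + c *: m = 0 -> u = 0 /\ c = 0.
Proof.
move=> lf f0 fm u c E; have c0 : c = 0.
  apply/eqP/negP => /negP c0; apply: fm; exists (- c^-1 *: u).
  rewrite (is_linearZ lf); apply: (scalerI c0).
  by rewrite scalerA mulrN divff // scaleN1r; apply/eqP; rewrite -subr_eq0 opprK addrC E.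
by split=> //; apply: f0; rewrite c0 scale0r addr0 in E.
Qed.

Lemma scalar_linear M (m : M) : is_linear (fun c : 'rV[K]_1 => c 0 0 *: m).
Proof. by move=> a u v; rewrite !mxE scalerDl scalerA. Qed.

(** Vectors of [S] outside the image of [f] are adjoined to [f] as long as there are any;
    [free_family_le] bounds the size of the family by [t]. *)
Lemma basis_extension M (S T : M -> Prop) t s (f : 'rV[K]_s -> M) :
  is_subspace S -> fdim T t -> (forall m, S m -> T m) ->
  is_linear f -> (forall u, f u = 0 -> u = 0) -> (forall u, S (f u)) ->
  exists r (g : 'rV[K]_r -> M), [/\ is_linear g,
    (forall u v, f u + g v = 0 -> u = 0 /\ v = 0) &
    (forall m, S m <-> exists u v, m = f u + g v)].
Proof.
move=> [S0 SD] [h [lh h0 hT]] ST.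
(* The measure is [t.+1 - s] so that it still drops when [s = t]. *)
have [k] := ubnP (t.+1 - s)%N; elim: k => // k IH in s f * => ks lf f0 fS.
have sle : (s <= t)%N.
  by apply: (free_family_le lf lh f0) => u; apply/hT/ST/fS.
have [[m [Sm nm]] | all_im] := classic (exists m, S m /\ ~ exists u, m = f u); last first.
  exists 0%N, (fun _ => 0); split.
  - by move=> a u v; rewrite scaler0 addr0.
  - by move=> u v; rewrite addr0 => /f0 ->; split=> //; apply/rowP => -[].
  - move=> m; split=> [Sm | [u [v ->]]]; last by rewrite addr0.
    apply: NNPP => nm; apply: all_im; exists m; split=> // -[u mu].
    by apply: nm; exists u, 0; rewrite addr0.
have fm := extend_one lf f0 nm.
pose f1 (u : 'rV[K]_(s + 1)) := f (lsubmx u) + (rsubmx u : 'rV_1) 0 0 *: m.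
have row1 (c : 'rV[K]_1) : c 0 0 = 0 -> c = 0.
  by move=> c0; apply/rowP => j; rewrite ord1 c0 mxE.
have lf1 : is_linear f1.
  exact: (is_linear_join lf (scalar_linear m)).
have [|u|u|r [g [lg g0 gS]]] := IH _ f1 _ lf1.
- lia.
- rewrite /f1 => /fm[l0 /row1 r0]; by rewrite -(hsubmxK u) l0 r0 row_mx0.
- by rewrite /f1 addrC; apply: SD.
(* The adjoined vector [m] passes from [f1] to the front of the complement [g]. *)
exists (1 + r)%N, (fun v => (lsubmx v : 'rV_1) 0 0 *: m + g (rsubmx v)); split.
- exact: (is_linear_join (scalar_linear m) lg).
- move=> u v; rewrite addrA => E.
  have := g0 (row_mx u (lsubmx v)) (rsubmx v); rewrite /f1 row_mxKl row_mxKr => /(_ E)[].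
  rewrite -(row_mx0 K 1 s 1) => /eq_row_mx[-> l0] r0; split=> //.
  by rewrite -(hsubmxK v) l0 r0 row_mx0.
- move=> x; split=> [/gS[u [v ->]] | [u [v ->]]].
    exists (lsubmx u), (row_mx (rsubmx u) v).
    by rewrite row_mxKl row_mxKr addrA.
  apply/gS; exists (row_mx u (lsubmx v)), (rsubmx v).
  by rewrite /f1 row_mxKl row_mxKr addrA.
Qed.

Lemma fdim_sub M (S T : M -> Prop) t :
  is_subspace S -> fdim T t -> (forall m, S m -> T m) -> exists s, fdim S s.
Proof.
move=> sS Tt ST; have [S0 _] := sS.
have [|u|u|r [g [lg g0 gS]]] := basis_extension (f := fun _ : 'rV[K]_0 => 0 : M) sS Tt ST.
- by move=> a u v; rewrite scaler0 addr0.
- by move=> _; apply/rowP => -[].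
- by [].
exists r, g; split=> // [u gu0 | m].
  by have [] := g0 0 u _; rewrite ?add0r.
split=> [/gS[u [v ->]] | [u ->]]; first by exists v; rewrite add0r.
by apply/gS; exists 0, u; rewrite add0r.
Qed.

Lemma fdim_between M (S T : M -> Prop) s t c :
  fdim S s -> fdim T t -> (forall m, S m -> T m) -> (s <= c <= t)%N ->
  exists C : M -> Prop, [/\ fdim C c, (forall m, S m -> C m) & (forall m, C m -> T m)].
Proof.
move=> Ss Tt ST /andP[]; elim: c => [|c IH] sc ct.
  by exists S; split=> //; move: sc Ss; rewrite leqn0 => /eqP ->.
have [<-|neq] := eqVneq s c.+1; first by exists S.
have [||C [Cc SC CT]] := IH; [lia | lia |].
have [[m [Tm nm]] | TC] := classic (exists m, T m /\ ~ C m); last first.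
  suff : (t <= c)%N by lia.
  apply: fdim_le Tt Cc _ => m Tm; apply: NNPP => nm; apply: TC; by exists m.
have [f [lf f0 fC]] := Cc.
have fm : ~ exists u, m = f u by move/fC.
have ext := extend_one lf f0 fm.
exists (fun x => exists u (v : 'rV[K]_1), x = f u + v 0 0 *: m); split.
- rewrite -[c.+1]addn1; apply: (fdim_join lf (scalar_linear m)) => // u v /ext[-> v0].
  by split=> //; apply/rowP => j; rewrite ord1 v0 mxE.
- by move=> x /SC/fC[u ->]; exists u, 0; rewrite mxE scale0r addr0.
- move=> x [u [v ->]]; rewrite addrC; have [_ TD] := fdim_subspace Tt.
  by apply: TD => //; apply/CT/fC; exists u.
Qed.

(** A basis of the kernel is extended to [S]; the added vectors map to a basis of the image. *)
Lemma rank_nullity M N (S : M -> Prop) (f : M -> N) d : is_linear f -> fdim S d ->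
  exists k r, [/\ fdim (fun m => S m /\ f m = 0) k,
                  fdim (fun y => exists2 m, S m & y = f m) r & d = (k + r)%N].
Proof.
move=> lf Sd; have [S0 SD] := fdim_subspace Sd.
have [| m [] // |k Kk] := fdim_sub (S := fun m => S m /\ f m = 0) _ Sd.
  split; first by rewrite (is_linear0 lf).
  move=> a u v [Su u0] [Sv v0]; split; first exact: SD.
  by rewrite lf u0 v0 scaler0 addr0.
have [h [lh h0 hK]] := Kk.
have hker u : S (h u) /\ f (h u) = 0 by apply/hK; exists u.
have [r [g [lg g0 gS]]] := basis_extension (fdim_subspace Sd) Sd (fun _ => id) lh h0
  (fun u => (hker u).1).
have Sg v : S (g v) by apply/gS; exists 0, v; rewrite (is_linear0 lh) add0r.
exists k, r; split=> //; last by apply: (fdim_uniq Sd); apply: fdim_join gS.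
exists (f \o g); split=> [a u v | u /= fg0 | y] /=.
- by rewrite lg lf.
- have /hK[v E] : S (g u) /\ f (g u) = 0 by [].
  have [] // := g0 (- v) u.
  by rewrite (is_linearN lh) -E addNr.
- split=> [[m /gS[u [v ->]] ->] | [u ->]]; last by exists (g u).
  by exists v; rewrite (is_linearD lf) (hker u).2 add0r.
Qed.

(** Converse of [rank_nullity]: here finite-dimensionality of [S] is a conclusion, reached by
    lifting a basis of the image and joining it to the kernel. *)
Lemma fdim_extension M N (S : M -> Prop) (f : M -> N) k r : is_linear f ->
  is_subspace S -> fdim (fun m => S m /\ f m = 0) k ->
  fdim (fun y => exists2 m, S m & y = f m) r -> fdim S (k + r).
Proof.
move=> lf [S0 SD] [h [lh h0 hK]] [g [lg g0 gI]].
have lift i : exists m, S m /\ g (delta_mx 0 i) = f m.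
  by have /gI[m Sm E] : exists u, g (delta_mx 0 i) = g u; [exists (delta_mx 0 i) | exists m].
have [b Hb] := fin_all_exists lift.
pose g' (u : 'rV[K]_r) := \sum_j u 0 j *: b j.
have lg' : is_linear g' by apply: lin_comb_linear.
have Sg' u : S (g' u).
  by rewrite /g'; elim/big_rec: _ => // i x _ Sx; apply: SD => //; case: (Hb i).
have fg' u : f (g' u) = g u.
  rewrite (is_linear_row lg) (is_linear_sum lf); apply: eq_bigr => j _.
  by rewrite (is_linearZ lf) (Hb j).2.
have hker u : S (h u) /\ f (h u) = 0 by apply/hK; exists u.
apply: (fdim_join lh lg') => [u v E | m].
- have v0 : v = 0.
    apply: g0; have := congr1 f E.
    by rewrite (is_linearD lf) (hker u).2 add0r fg' (is_linear0 lf).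
  by split=> //; apply: h0; rewrite v0 (is_linear0 lg') addr0 in E.
- split=> [Sm | [u [v ->]]].
    have /gI[v Ev] : exists2 x, S x & f m = f x by exists m.
    have /hK[u Eu] : S (m - g' v) /\ f (m - g' v) = 0.
      split; last by rewrite (is_linearB lf) fg' Ev subrr.
      by rewrite addrC -scaleN1r; apply: SD.
    by exists u, v; rewrite -Eu subrK.
  rewrite -[h u]scale1r; apply: SD => //; exact: (hker u).1.
Qed.

Lemma fdim_prod (I : finType) M (P : I -> M -> Prop) (D : I -> nat) :
  (forall i, fdim (P i) (D i)) ->
  fdim (fun f : {ffun I -> M} => forall i, P i (f i)) (\sum_i D i).
Proof.
move=> PD; have P0 i : is_subspace (P i) := fdim_subspace (PD i).
(* Induction on the list of allowed coordinates: evaluation at a new index [j] has as kernel the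
   families supported on the shorter list. *)
suff H (l : seq I) : uniq l ->
    fdim (fun f : {ffun I -> M} => forall i, if i \in l then P i (f i) else f i = 0)
      (\sum_(i <- l) D i).
  have -> : (\sum_i D i = \sum_(i <- enum I) D i)%N by rewrite big_enum.
  apply: fdim_ext (H _ (enum_uniq I)) => f.
  by split=> H' i; move: (H' i); rewrite mem_enum.
elim: l => [|j l IH] /=.
  move=> _; rewrite big_nil; apply: fdim_ext (fdim_zero _) => f.
  split=> [-> i | f0]; first by rewrite ffunE.
  by apply/ffunP => i; rewrite ffunE; apply: f0.
move=> /andP[jl ul]; rewrite big_cons addnC.
apply: (fdim_extension (f := fun f : {ffun I -> M} => f j)).
- by move=> a u v; rewrite !ffunE.
- split=> [i | a u v Hu Hv i]; rewrite !ffunE; first by case: ifP => // _; case: (P0 i).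
  move: (Hu i) (Hv i); case: ifP => _; first exact: (P0 i).2.
  by move=> -> ->; rewrite scaler0 addr0.
- apply: fdim_ext (IH ul) => f; split=> [Hf | [Hf fj] i].
    have fj : f j = 0 by have := Hf j; rewrite (negbTE jl).
    split=> // i; move: (Hf i); rewrite inE; case: eqVneq => //= -> _.
    by rewrite fj; case: (P0 j).
  by move: (Hf i); rewrite inE; case: eqVneq => //= ->; rewrite (negbTE jl).
- apply: fdim_ext (PD j) => y; split=> [Py | [f Hf ->]]; last first.
    by move: (Hf j); rewrite inE eqxx.
  exists [ffun i => if i == j then y else 0]; last by rewrite ffunE eqxx.
  move=> i; rewrite ffunE inE; case: eqVneq => [-> // | _] /=.
  by case: ifP => // _; case: (P0 i).
Qed.

Lemma fdim_image M N (S : M -> Prop) (f : M -> N) d :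
  is_linear f -> injective f -> fdim S d -> fdim (fun y => exists2 m, S m & y = f m) d.
Proof.
move=> lf fI [g [lg g0 gS]]; exists (f \o g); split=> [a u v | u /= | y] /=.
- by rewrite lg lf.
- by rewrite -(is_linear0 lf) => /fI/g0.
- split=> [[m /gS[u ->] ->] | [u ->]]; first by exists u.
  by exists (g u) => //; apply/gS; exists u.
Qed.

Lemma fdim_regular : fdim (fun _ : K^o => True) 1.
Proof.
exists (fun c : 'rV[K]_1 => c 0 0); split=> [a u v | u u0 | m].
- by rewrite !mxE.
- by apply/rowP => j; rewrite ord1 u0 mxE.
- by split=> // _; exists (const_mx m); rewrite mxE.
Qed.

End FinDim.

(** * The dot action *)

Section Cartan.
Variables (n : nat) (A : finType) (src tgt : A -> 'I_n).
Hypothesis noloop : forall a, src a != tgt a.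
Implicit Types (w : 'I_n -> nat) (i j k : 'I_n) (u v : 'I_n -> int).

Notation cartan := (cartan src tgt).
Notation sref_dot := (sref_dot src tgt).

(** The pairing of the simple coroot at [i] with alpha_v. *)
Definition cartan_act v i : int := \sum_k cartan i k * v k.

(** The reflection s_i on the root lattice, which is the linear part of the affine map
    [sref_dot w i]. *)
Definition sref_lin i u : 'I_n -> int :=
  fun j => if j == i then u i - cartan_act u i else u j.

(* [wpair w v u] is the pairing of omega_w - alpha_v with alpha_u. *)
Definition wpair w v u : int := \sum_j u j * ((w j)%:Z - cartan_act v j).

Lemma cartan_sym i j : cartan i j = cartan j i.
Proof. by rewrite /cartan eq_sym addnC. Qed.

(** Without loops each edge at [i] is counted by exactly one double arrow leaving [i], so the Cartan
    pairing becomes the arrow sum that [fdim_fam] produces. *)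
Lemma cartan_actE v i :
  cartan_act v i = v i *+ 2 - \sum_(d : darr A | dsrc src tgt d == i) v (dtgt src tgt d).
Proof.
have cE k : cartan i k = (i == k)%:R *+ 2
    - (\sum_a ((src a == i) && (tgt a == k))%:R + \sum_a ((src a == k) && (tgt a == i))%:R).
  rewrite /cartan; case: eqVneq => [<-|_].
    have loop a : (src a == i) && (tgt a == i) = false.
      by apply/negP => /andP[/eqP si /eqP ti]; have := noloop a; rewrite si ti eqxx.
    by rewrite !big1 ?addr0 ?subr0 // => a _; rewrite loop.
  by rewrite mul0rn add0r -[Posz _]natz natrD -!sum1_card !natr_sum; congr (- (_ + _));
     rewrite big_mkcond; apply: eq_bigr => a _; rewrite inE; case: ifP.
rewrite /cartan_act; under eq_bigr => k _ do rewrite cE mulrBl.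
rewrite sumrB; congr (_ - _).
  rewrite (bigD1 i) //= eqxx big1 ?addr0 => [|k /negbTE]; first by rewrite mulr_natl.
  by rewrite eq_sym => ->; exact: mul0r.
under eq_bigr do rewrite mulrDl.
rewrite big_split big_sumType /=; congr (_ + _).
  under eq_bigr do rewrite mulr_suml.
  rewrite exchange_big /= [RHS]big_mkcond; apply: eq_bigr => a _ /=.
  case: eqVneq => _ /=; last by rewrite big1 // => k _; rewrite mul0r.
  rewrite (bigD1 (tgt a)) //= eqxx mul1r big1 ?addr0 // => k /negbTE.
  by rewrite eq_sym => ->; rewrite mul0r.
under eq_bigr do rewrite mulr_suml.
rewrite exchange_big /= [RHS]big_mkcond; apply: eq_bigr => a _ /=.
case: (tgt a == i) => /=; last by rewrite big1 // => k _; rewrite andbF mul0r.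
rewrite (bigD1 (src a)) //= eqxx mul1r big1 ?addr0 // => k /negbTE.
by rewrite eq_sym => ->; rewrite mul0r.
Qed.

Lemma cartan_act_ext u v : u =1 v -> cartan_act u =1 cartan_act v.
Proof. by move=> uv i; apply: eq_bigr => k _; rewrite uv. Qed.

Lemma cartan_actD u v : cartan_act (fun j => u j + v j) =1 (fun j => cartan_act u j + cartan_act v j).
Proof. by move=> i; rewrite -big_split; apply: eq_bigr => k _; rewrite mulrDr. Qed.

Lemma cartan_act_delta i (c : int) j :
  cartan_act (fun k => if k == i then c else 0) j = cartan j i * c.
Proof.
rewrite /cartan_act (bigD1 i) //= eqxx big1 ?addr0 // => k /negbTE ->.
by rewrite mulr0.
Qed.

Lemma sref_dotE w i v j :
  sref_dot w i v j = v j + (if j == i then (w i)%:Z - cartan_act v i else 0).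
Proof. by rewrite /sref_dot; case: eqP => [->|_]; rewrite ?addr0 // addrA. Qed.

Lemma cartan_act_sref_dot w i v j :
  cartan_act (sref_dot w i v) j
  = cartan_act v j + cartan j i * ((w i)%:Z - cartan_act v i).
Proof.
by rewrite (cartan_act_ext (sref_dotE w i v)) cartan_actD cartan_act_delta.
Qed.

Lemma cartan_diag i : cartan i i = 2.
Proof. by rewrite /cartan eqxx. Qed.

(** The dot action is affine with linear part [sref_lin], and s_i is an involution. *)
Lemma sref_dot_sref_dotD w i v u j :
  sref_dot w i (fun k => sref_dot w i v k + u k) j = v j + sref_lin i u j.
Proof.
rewrite sref_dotE cartan_actD cartan_act_sref_dot cartan_diag /sref_lin sref_dotE.
case: eqVneq => [->|_]; last by rewrite !addr0.
by ring.
Qed.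

Lemma sref_dotK w i v : sref_dot w i (sref_dot w i v) =1 v.
Proof.
move=> j; rewrite sref_dotE cartan_act_sref_dot cartan_diag sref_dotE.
case: eqVneq => [->|_]; last by rewrite !addr0.
by ring.
Qed.

(** Weyl invariance of the pairing; it rests on the symmetry of the Cartan matrix. *)
Lemma wpair_sref w i v u : wpair w v (sref_lin i u) = wpair w (sref_dot w i v) u.
Proof.
have -> : wpair w v (sref_lin i u)
    = wpair w v u - cartan_act u i * ((w i)%:Z - cartan_act v i).
  rewrite /wpair (bigD1 i) //= [in RHS](bigD1 i) //= /sref_lin eqxx.
  have -> : \sum_(j | j != i) (if j == i then u i - cartan_act u i else u j)
       * ((w j)%:Z - cartan_act v j) = \sum_(j | j != i) u j * ((w j)%:Z - cartan_act v j).
    by apply: eq_bigr => j /negbTE ->.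
  by ring.
rewrite /wpair [cartan_act u i]/cartan_act mulr_suml -sumrB.
apply: eq_bigr => j _; rewrite cartan_act_sref_dot (cartan_sym i j).
by ring.
Qed.

Lemma wpair_delta w v i (c : int) :
  wpair w v (fun j => if j == i then c else 0) = c * ((w i)%:Z - cartan_act v i).
Proof.
rewrite /wpair (bigD1 i) //= eqxx big1 ?addr0 // => k /negbTE ->.
by rewrite mul0r.
Qed.

End Cartan.

(** * Changing a submodule at one vertex *)

Section Modules.
Variables (K : fieldType) (n : nat) (A : finType) (src tgt : A -> 'I_n).
Variables (M : lmodType K) (p : pmod_ops n A M).
Hypothesis Mp : is_pmod src tgt p.
Implicit Types (S C : M -> Prop) (i j k : 'I_n) (d : darr A) (m : M).

Notation dsrc := (dsrc src tgt).
Notation dtgt := (dtgt src tgt).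

Lemma pe_linear i : is_linear (pe p i).
Proof. by case: Mp => -[]. Qed.

Lemma px_linear d : is_linear (px p d).
Proof. by case: Mp => -[]. Qed.

Lemma pe_pe i j m : pe p i (pe p j m) = if i == j then pe p i m else 0.
Proof. by case: Mp. Qed.

Lemma sum_pe m : \sum_(i < n) pe p i m = m.
Proof. by case: Mp. Qed.

Lemma pe_id i m : pe p i (pe p i m) = pe p i m.
Proof. by rewrite pe_pe eqxx. Qed.

Lemma pe0 i : pe p i 0 = 0. Proof. exact: is_linear0 (pe_linear i). Qed.
Lemma px0 d : px p d 0 = 0. Proof. exact: is_linear0 (px_linear d). Qed.

Lemma px_pe d j m : px p d (pe p j m) = if dsrc d == j then px p d m else 0.
Proof.
have [_ _ _ xE _] := Mp; rewrite [LHS]xE pe_pe.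
by case: eqVneq => _; rewrite -?xE ?px0 ?pe0.
Qed.

Lemma pe_px d j m : pe p j (px p d m) = if dtgt d == j then px p d m else 0.
Proof.
have [_ _ _ xE _] := Mp; rewrite [px p d m]xE pe_pe eq_sym.
by case: eqVneq => [->|].
Qed.

Definition vcomp S i m : Prop := S m /\ pe p i m = m.

Lemma submodule_subspace S : is_submodule p S -> is_subspace S.
Proof. by case. Qed.

Lemma comp_subspace S i : is_submodule p S -> is_subspace (vcomp S i).
Proof.
move=> [S0 SD _ _]; split; first by rewrite /vcomp pe0.
by move=> a u v [Su eu] [Sv ev]; split; [exact: SD | rewrite pe_linear eu ev].
Qed.

Lemma subspace_sum S (I : finType) (F : I -> M) : is_subspace S ->
  (forall x, S (F x)) -> S (\sum_x F x).
Proof.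
move=> [S0 SD] SF; elim/big_rec: _ => // x y _ Sy.
by rewrite -[F x]scale1r; apply: SD.
Qed.

Lemma submodule_pe S m : is_submodule p S -> (forall i, S (pe p i m)) -> S m.
Proof.
by move=> sS Sm; rewrite -(sum_pe m); apply: subspace_sum => //; exact: submodule_subspace.
Qed.

Lemma gdim_fdimP S (u : 'I_n -> int) : is_submodule p S ->
  gdim p S u <-> exists v : 'I_n -> nat, forall i, u i = (v i)%:Z /\ fdim (vcomp S i) (v i).
Proof.
move=> sS; split=> [Su | [v uv] i].
  suff H i : exists r : nat, u i = r%:Z /\ fdim (vcomp S i) r.
    by have [v] := fin_all_exists H; exists v.
  have [d [b [ud Sb b0 bS]]] := Su i; exists d; split=> //.
  apply/(fdim_basisP _ (comp_subspace i sS)); exists b; split=> // m [Sm em].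
  exact: bS.
have [ui /(fdim_basisP _ (comp_subspace i sS))[b [Sb b0 bS]]] := uv i.
by exists (v i), b; split=> // m Sm em; apply: bS.
Qed.

Lemma gdim_ext S (u v : 'I_n -> int) : u =1 v -> gdim p S u -> gdim p S v.
Proof.
by move=> uv Su i; have [d [b [ud Sb b0 bS]]] := Su i; exists d, b; split; rewrite // -uv.
Qed.

(* [splice S i C] agrees with [S] away from the vertex [i] and is [C] at [i]; it
   is a submodule when the subspace [C] lies between [below S i] and [above S i]. *)
Definition splice S i C m : Prop := (forall j, j != i -> S (pe p j m)) /\ C (pe p i m).

Definition above S i m : Prop := pe p i m = m /\ forall d, S (px p d m).

(* [fam], [inn] and [d |-> px p d m] form the complex
   M_i -> (+)_(d : i -> j) M_j -> M_i given by the preprojective relation at [i]. *)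
Definition fam S i (f : {ffun darr A -> M}) : Prop :=
  forall d, if dsrc d == i then vcomp S (dtgt d) (f d) else f d = 0.

Definition inn (f : {ffun darr A -> M}) : M :=
  \sum_a (px p (inl a) (f (inr a)) - px p (inr a) (f (inl a))).

(** Written as an image under [inn], rather than as a span of arrow images, so that [rank_nullity]
    computes its dimension. *)
Definition below S i m : Prop := exists2 f, fam S i f & m = inn f.

Lemma inn_linear : is_linear inn.
Proof.
move=> a f g; rewrite /inn scaler_sumr -big_split; apply: eq_bigr => b _ /=.
by rewrite !ffunE !px_linear scalerBr opprD addrACA.
Qed.

Hypothesis noloop : forall a, src a != tgt a.

Lemma dsrc_neq_dtgt d : dsrc d != dtgt d.
Proof. by case: d => a /=; rewrite // eq_sym. Qed.

Definition opp d : darr A := match d with inl a => inr a | inr a => inl a end.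

Definition single d m : {ffun darr A -> M} := [ffun d' => if d' == d then m else 0].

Lemma inn_single d m : inn (single (opp d) m) = px p d m \/ inn (single (opp d) m) = - px p d m.
Proof.
case: d => a; [left | right]; rewrite /inn (bigD1 a) //= big1 => [|b ba]; rewrite !ffunE /=.
- by rewrite !eqxx px0 subr0 addr0.
- by rewrite !px0 subr0 !(inj_eq inr_inj) (negbTE ba) px0.
- by rewrite !eqxx px0 sub0r addr0.
- by rewrite !px0 sub0r !(inj_eq inl_inj) (negbTE ba) px0 oppr0.
Qed.

Lemma fam0 S i : is_submodule p S -> fam S i 0.
Proof.
by move=> sS d; rewrite ffunE; case: ifP => // _; case: (comp_subspace (dtgt d) sS).
Qed.

Lemma fam_subspace S i : is_submodule p S -> is_subspace (fam S i).
Proof.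
move=> sS; split; first exact: fam0.
move=> a f g Ff Fg d; rewrite !ffunE; move: (Ff d) (Fg d); case: ifP => _.
  exact: (comp_subspace (dtgt d) sS).2.
by move=> -> ->; rewrite scaler0 addr0.
Qed.

Lemma above_subspace S i : is_submodule p S -> is_subspace (above S i).
Proof.
move=> [S0 SD _ _]; split; first by split=> [|d]; rewrite ?pe0 ?px0.
move=> a u v [eu Su] [ev Sv]; split=> [|d]; first by rewrite pe_linear eu ev.
by rewrite px_linear; apply: SD.
Qed.

Lemma comp_above S i m : is_submodule p S -> vcomp S i m -> above S i m.
Proof. by move=> [_ _ _ Sx] [Sm em]; split=> // d; apply: Sx. Qed.

(** The family with the single entry e_(source) m at the opposite arrow is sent by [inn] to the
    image of [m] under [d], up to the sign of the preprojective relation. *)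
Lemma below_px S d m : is_submodule p S -> S m -> below S (dtgt d) (px p d m).
Proof.
move=> sS Sm; have [S0 SD Se Sx] := sS.
have F x : vcomp S (dsrc d) x -> fam S (dtgt d) (single (opp d) x).
  move=> Cx d'; rewrite ffunE.
  have opE : dsrc (opp d) = dtgt d /\ dtgt (opp d) = dsrc d by case: (d).
  case: (eqVneq d' (opp d)) => [->|_]; first by rewrite opE.1 opE.2 eqxx.
  by case: ifP => // _; split; rewrite ?pe0.
have Cx : vcomp S (dsrc d) (pe p (dsrc d) m) by split; [exact: Se | exact: pe_id].
have -> : px p d m = px p d (pe p (dsrc d) m) by rewrite px_pe eqxx.
have [E|E] := inn_single d (pe p (dsrc d) m).
  by exists (single (opp d) (pe p (dsrc d) m)); [exact: F | rewrite E].
exists (- (single (opp d) (pe p (dsrc d) m))); last first.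
  by rewrite (is_linearN inn_linear) E opprK.
have [_ H] := fam_subspace (dtgt d) sS.
rewrite -scaleN1r -[_ *: _]addr0; exact: (H _ _ _ (F _ Cx) (fam0 (dtgt d) sS)).
Qed.

Lemma below_comp S i m : is_submodule p S -> below S i m -> vcomp S i m.
Proof.
move=> sS [f Ff ->]; have [S0 SD Se Sx] := sS.
have Fd d : S (f d) by move: (Ff d); case: ifP => _; [case | move=> ->].
have innE : pe p i (inn f) = inn f.
  rewrite /inn (is_linear_sum (pe_linear i)); apply: eq_bigr => a _.
  rewrite (is_linearB (pe_linear i)) !pe_px /=.
  congr (_ - _).
    by have := Ff (inr a); rewrite /=; case: ifP => // _ ->; rewrite px0.
  by have := Ff (inl a); rewrite /=; case: ifP => // _ ->; rewrite px0.
split=> //; rewrite /inn; apply: subspace_sum; first exact: submodule_subspace.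
by move=> a; rewrite addrC -scaleN1r; apply: SD; apply: Sx.
Qed.

(** Arrows leaving [i] stay in [S] because [C] lies in [above S i]. Arrows ending at [i] start at
    another vertex, as there are no loops, so they land in [below S i]. *)
Lemma splice_submodule S i C : is_submodule p S -> is_subspace C ->
  (forall m, below S i m -> C m) -> (forall m, C m -> above S i m) ->
  is_submodule p (splice S i C).
Proof.
move=> sS [C0 CD] BC CV; have [S0 SD Se Sx] := sS; split.
- by split=> [j _|]; rewrite pe0.
- move=> a u v [Su Cu] [Sv Cv]; split=> [j ji|]; rewrite pe_linear.
    by apply: SD; [exact: Su | exact: Sv].
  exact: CD.
- move=> j m [Sm Cm]; split=> [k ki|]; rewrite pe_pe; last by case: ifP.
  by case: ifP => // _; exact: Sm.
- move=> d m [Sm Cm].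
  have xm : S (px p d m).
    have -> : px p d m = px p d (pe p (dsrc d) m) by rewrite px_pe eqxx.
    have [->|/Sm] := eqVneq (dsrc d) i; last exact: Sx.
    by have [_ ] := CV _ Cm.
  split=> [j ji|]; first exact: Se.
  rewrite pe_px; case: eqP => // di; apply: BC; rewrite -di.
  have -> : px p d m = px p d (pe p (dsrc d) m) by rewrite px_pe eqxx.
  by apply: below_px => //; apply: Sm; rewrite -di dsrc_neq_dtgt.
Qed.

Lemma sub_splice S i C m : is_submodule p S -> (forall m, vcomp S i m -> C m) ->
  S m -> splice S i C m.
Proof.
move=> [S0 SD Se Sx] SC Sm; split=> [j _|]; first exact: Se.
by apply: SC; split; [exact: Se | exact: pe_id].
Qed.

Lemma comp_splice_eq S i C m : is_submodule p S -> (forall m, C m -> pe p i m = m) ->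
  vcomp (splice S i C) i m <-> C m.
Proof.
move=> [S0 SD Se Sx] Ci; split=> [[[_ Cm] <-] // | Cm]; have em := Ci _ Cm.
split=> //; split=> [j ji|]; last by rewrite em.
by rewrite -em pe_pe (negbTE ji).
Qed.

Lemma comp_splice_neq S i C j m : is_submodule p S -> is_subspace C -> j != i ->
  vcomp (splice S i C) j m <-> vcomp S j m.
Proof.
move=> [S0 SD Se Sx] [C0 CD] ji; split=> [[[Sm _] em] | [Sm em]].
  by split=> //; rewrite -em; apply: Sm.
split=> //; split=> [k _|]; first exact: Se.
by rewrite -em pe_pe eq_sym (negbTE ji).
Qed.

Lemma gdim_splice S i C (u : 'I_n -> int) c : is_submodule p S ->
  fdim C c -> (forall m, below S i m -> C m) -> (forall m, C m -> above S i m) ->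
  gdim p S u -> gdim p (splice S i C) (fun j => if j == i then c%:Z else u j).
Proof.
move=> sS Cc BC CV Su; have sC := fdim_subspace Cc.
apply/gdim_fdimP; first exact: splice_submodule.
have /(gdim_fdimP _ sS)[v uv] := Su.
exists (fun j => if j == i then c else v j) => j.
case: eqVneq => [->|ji]; split=> //.
- apply: fdim_ext Cc => m; apply: iff_sym; apply: comp_splice_eq => //.
  by move=> x /CV[].
- exact: (uv j).1.
- by apply: fdim_ext (uv j).2 => m; apply: iff_sym; apply: comp_splice_neq.
Qed.

Lemma fdim_fam S i (v : 'I_n -> nat) : (forall j, fdim (vcomp S j) (v j)) ->
  fdim (fam S i) (\sum_(d : darr A | dsrc d == i) v (dtgt d)).
Proof.
move=> Sv; rewrite big_mkcond; apply: (@fdim_prod _ _ _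
  (fun d m => if dsrc d == i then vcomp S (dtgt d) m else m = 0)) => d.
by case: ifP => _; [exact: Sv | exact: fdim_zero].
Qed.

(** * Elements killed by all long paths *)

Lemma killed_zero N : killed_by_paths p N 0.
Proof. by move=> ds _; elim: ds => //= d ds ->; rewrite px0. Qed.

Lemma killed0 m : killed_by_paths p 0 m -> m = 0.
Proof. by move/(_ [::] erefl). Qed.

(** The arrow acting first is the last entry of the list, hence the case analysis from the right. *)
Lemma killedS N m : killed_by_paths p N.+1 m <-> forall d, killed_by_paths p N (px p d m).
Proof.
split=> [H d ds sz | H ds].
  by have := H (rcons ds d); rewrite size_rcons sz foldr_rcons; apply.
case/lastP: ds => // ds d; rewrite size_rcons foldr_rcons => -[sz].
exact: H.
Qed.

Lemma killed_le N N' m : (N <= N')%N -> killed_by_paths p N m -> killed_by_paths p N' m.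
Proof.
elim: N N' m => [|N IH] N' m; first by move=> _ /killed0 ->; exact: killed_zero.
case: N' => // N' le_N /killedS H; apply/killedS => d; exact: IH.
Qed.

Lemma foldr_px_linear (ds : seq (darr A)) : is_linear (fun m => foldr (fun d v => px p d v) m ds).
Proof. by elim: ds => //= d ds IH a u v; rewrite IH px_linear. Qed.

Lemma loc_nilp_submodule : is_submodule p (fun m => exists N, killed_by_paths p N m).
Proof.
split.
- by exists 0%N; apply: killed_zero.
- move=> a u v [N1 k1] [N2 k2]; exists (maxn N1 N2) => ds sz.
  rewrite foldr_px_linear (killed_le (leq_maxl N1 N2) k1 sz).
  by rewrite (killed_le (leq_maxr N1 N2) k2 sz) scaler0 addr0.
(* The bound is raised by one so that [killedS] applies; the first arrow then absorbs the idempotent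
   or gives 0. *)
- move=> i m [N kN]; exists N.+1; apply/killedS => d; rewrite px_pe.
  have /killedS H := killed_le (leqnSn N) kN.
  by case: ifP => _; [exact: H | exact: killed_zero].
- move=> d m [N kN]; exists N.
  by have /killedS := killed_le (leqnSn N) kN.
Qed.

End Modules.

(** * Injective hulls *)

Section OnePointExtension.
Variables (K : fieldType) (n : nat) (A : finType) (src tgt : A -> 'I_n).
Variables (M : lmodType K) (p : pmod_ops n A M).
Hypothesis Mp : is_pmod src tgt p.
Variables (i : 'I_n) (f : {ffun darr A -> M}).
Hypothesis Ff : fam src tgt p (fun _ => True) i f.

(** An extension of s^i by [M] with cocycle [f]; the pair [(0, 1)] lifts the generator of s^i. *)
Definition ext_ops : pmod_ops n A (M * K^o)%type :=
  PModOps (fun j (y : M * K^o) => (pe p j y.1, if i == j then y.2 else 0))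
          (fun d (y : M * K^o) => (px p d y.1 + (y.2 : K) *: f d, 0 : K^o)).

(** On the vector [(0, 1)] the preprojective relation reads exactly [inn p f = 0]. *)
Lemma ext_pmod : inn p f = 0 -> is_pmod src tgt ext_ops.
Proof.
move=> f0; split=> /=.
- split=> [j|d] a [u1 u2] [v1 v2] /=; congr pair.
  + exact: (pe_linear Mp).
  + by rewrite /=; case: (i == j); rewrite ?scaler0 ?addr0.
  + rewrite /= (px_linear Mp) scalerDl -scalerA. by rewrite scalerDr addrACA.
  + by rewrite /= scaler0 addr0.
- move=> j k [u1 u2] /=; rewrite (pe_pe Mp); case: (eqVneq j k) => [->|jk].
    by rewrite /= ?eqxx; case: (i == k).
  congr pair; case: eqP => // ->; case: eqP => // ik.
  by rewrite ik eqxx in jk.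
- move=> [u1 u2]; apply: injective_projections.
    by rewrite (is_linear_sum (f := fst)) //=; exact: (sum_pe Mp).
  rewrite (is_linear_sum (f := snd)) //= -big_mkcond /= (big_pred1 i) //.
- move=> d [u1 u2] /=; congr pair; last by rewrite if_same.
  rewrite (is_linearD (pe_linear Mp _)) (is_linearZ (pe_linear Mp _)).
  rewrite (pe_px Mp) (px_pe Mp) !eqxx; congr (_ + _).
  have := Ff d; rewrite eq_sym; case: eqP => [_ [_ ->] // | _ ->].
  by rewrite (pe0 Mp) !scaler0.
- move=> [u1 u2]; apply: injective_projections; last first.
    by rewrite (is_linear_sum (f := snd)) //= big1 // => a _; rewrite subr0.
  rewrite (is_linear_sum (f := fst)) //=.
  have [_ _ _ _ rel] := Mp.
  transitivity (\sum_a (px p (inl a) (px p (inr a) u1) - px p (inr a) (px p (inl a) u1))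
     + u2 *: inn p f); last by rewrite rel f0 scaler0 addr0.
  rewrite /inn scaler_sumr -big_split; apply: eq_bigr => a _ /=.
  rewrite !scale0r !addr0 !(is_linearD (px_linear Mp _)) !(is_linearZ (px_linear Mp _)).
  by rewrite scalerBr opprD addrACA.
Qed.

(* Injectivity of [M] retracts the extension, which is Ext^1(s^i, M) = 0 at the
   middle term of the presentation of [s^i]. *)
Lemma injective_exact : injective_in (@catMod K n A src tgt) p (fun _ => True) ->
  inn p f = 0 -> exists m, pe p i m = m /\ forall d, px p d m = f d.
Proof.
move=> inj f0.
have [||||||h [[lh he hx] _ hid]] := inj M (M * K^o)%type p ext_ops (fun m => (m, 0)) id.
- exact: Mp.
- exact: ext_pmod.
- split=> [a u v | j m | d m] /=.
  + by congr pair; rewrite /= scaler0 addr0.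
  + by rewrite if_same.
  + by rewrite scale0r addr0.
- by move=> u v [].
- by split.
- by [].
(* The retraction [h] fixes [M], and in the extension [d] sends [(0, 1)] to [f d]. *)
exists (h (0, 1)); split=> [|d].
  by rewrite -he /= eqxx (pe0 Mp).
by rewrite -hx /= (px0 Mp) add0r scale1r hid.
Qed.

End OnePointExtension.

(** * Multiplicities in the semisimple module s^w *)

Section Socle.
Variables (K : fieldType) (n : nat) (A : finType) (w : 'I_n -> nat).

(** The ordinal bounding the second coordinate is large enough to contain all [k < w i], so only the
    condition [k < w i] restricts the pairs over [i]. *)
Lemma card_sidx (i : 'I_n) : #|[pred x : sidx w | (val x).1 == i]| = w i.
Proof.
have wle : (w i <= (\sum_(i < n) w i).+1)%N.
  by rewrite (bigD1 i) //= leqW // leq_addr.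
pose f (k : 'I_(w i)) : sidx w := exist (fun x : 'I_n * 'I_(\sum_(i < n) w i).+1 => is_true (x.2 < w x.1)%N) (i, widen_ord wle k) (ltn_ord k).
have fI : injective f.
  by move=> k l /(congr1 val)[] /val_inj.
rewrite -[RHS]card_ord -(card_codom fI); apply: eq_card => x.
rewrite inE; apply/eqP/codomP => [xi | [k ->] //].
case: x xi => -[j k] /= lt_k ji; subst j.
by exists (Ordinal lt_k); apply: val_inj; congr pair; apply: val_inj.
Qed.

Lemma fdim_sw (i : 'I_n) : fdim (fun t : SW K w => pe (sw_ops K A w) i t = t) (w i).
Proof.
rewrite -(card_sidx i) -sum1_card big_mkcond.
apply: fdim_ext (fdim_prod (P := fun (x : sidx w) (c : K^o) => if (val x).1 == i then True else c = 0) _).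
  move=> t; split=> [Ht | <- x].
    by apply/ffunP => x; rewrite ffunE; move: (Ht x); case: ifP.
  by rewrite ffunE; case: (_ == i).
move=> x; rewrite inE; case: ifP => _; [exact: fdim_regular | exact: fdim_zero].
Qed.

End Socle.

(** * Submodules of q^w and their graded dimensions *)

Section Hull.
Variables (K : fieldType) (n : nat) (A : finType) (src tgt : A -> 'I_n).
Hypothesis noloop : forall a, src a != tgt a.
Variables (w : 'I_n -> nat) (Q : lmodType K) (pQ : pmod_ops n A Q).
Hypothesis HQ : is_pmod src tgt pQ.
Variable iota : SW K w -> Q.
Hypothesis Hq : injective_hull_in (@catMod K n A src tgt) pQ (sw_ops K A w)
            (fun _ => True) iota.
Implicit Types (S : Q -> Prop) (sigma : seq 'I_n) (i j : 'I_n).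

Notation sref_dot := (sref_dot src tgt).
Notation wpair := (wpair src tgt w).
Notation below := (below src tgt pQ).
Notation above := (above pQ).
Notation orbit sigma := (wdot src tgt w sigma (fun _ => 0)).

Lemma iota_hom : is_hom (sw_ops K A w) pQ iota. Proof. by case: Hq. Qed.

Lemma iota_inj : injective iota. Proof. by case: Hq. Qed.

Lemma iota_pe i t : pe pQ i (iota t) = iota (pe (sw_ops K A w) i t).
Proof. by case: iota_hom => _ ->. Qed.

Lemma iota0 : iota 0 = 0.
Proof. by case: iota_hom => /is_linear0. Qed.

Lemma iota_px d t : px pQ d (iota t) = 0.
Proof. by case: iota_hom => l _ <-; rewrite /= iota0. Qed.

Lemma essentialQ S : is_submodule pQ S -> (exists m, S m /\ m <> 0) ->
  exists t, S (iota t) /\ iota t <> 0.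
Proof. by case: Hq => _ _ _ _ ess sS; apply: ess. Qed.

Lemma line_submodule i m : pe pQ i m = m -> (forall d, px pQ d m = 0) ->
  is_submodule pQ (fun x => exists c, x = c *: m).
Proof.
move=> em xm; split.
- by exists 0; rewrite scale0r.
- by move=> a _ _ [c1 ->] [c2 ->]; exists (a * c1 + c2); rewrite scalerDl scalerA.
- move=> j _ [c ->]; rewrite (is_linearZ (pe_linear HQ j)) -em (pe_pe HQ).
  case: ifP => [/eqP ->|_]; first by exists c; rewrite em.
  by exists 0; rewrite scale0r scaler0.
- move=> d _ [c ->]; rewrite (is_linearZ (px_linear HQ d)) xm.
  by exists 0; rewrite scale0r scaler0.
Qed.

(** By essentiality the line through a nonzero socle vector meets the image of [iota], so that
    vector is itself in the image; the socle at [i] is thus the part of s^w at [i]. *)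
Lemma fdim_socle i :
  fdim (fun m => pe pQ i m = m /\ forall d, px pQ d m = 0) (w i).
Proof.
have [ilin _ _] := iota_hom.
apply: fdim_ext (fdim_image ilin iota_inj (fdim_sw K A w i)) => m.
split=> [[t et ->] | [em xm]].
  by split=> [|d]; [rewrite iota_pe et | exact: iota_px].
have [-> | /eqP m0] := eqVneq m 0.
  by exists 0; rewrite ?iota0 //; apply/ffunP => x; rewrite !ffunE if_same.
have [t [[c tc] t0]] := essentialQ (line_submodule em xm)
  (ex_intro _ m (conj (ex_intro _ 1 (esym (scale1r m))) m0)).
have c0 : c != 0 by apply/eqP => c0; apply: t0; rewrite tc c0 scale0r.
have mE : m = iota (c^-1 *: t).
  by rewrite (is_linearZ ilin) tc scalerA mulVf // scale1r.
exists (c^-1 *: t) => //; apply: iota_inj; by rewrite -iota_pe -mE.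
Qed.

(** Sending [m] to all its arrow images maps [above S i] onto the kernel of [inn] on [fam S i], with
    the socle at [i] as kernel. Rank-nullity for [inn] supplies the other summand. *)
Lemma fdim_above_below S i (v : 'I_n -> nat) : is_submodule pQ S ->
  (forall j, fdim (vcomp pQ S j) (v j)) ->
  exists t b, [/\ fdim (above S i) t, fdim (below S i) b &
    (t + b = w i + \sum_(d : darr A | dsrc src tgt d == i) v (dtgt src tgt d))%N].
Proof.
move=> sS Sv; have [S0 SD Se Sx] := sS.
have [k [b [Zk Bb E]]] := rank_nullity (inn_linear HQ) (fdim_fam src tgt i Sv).
exists (w i + k)%N, b; split=> //; last by rewrite E addnA.
pose out (m : Q) : {ffun darr A -> Q} := [ffun d => px pQ d m].
have outlin : is_linear out.
  by move=> a u v'; apply/ffunP => d; rewrite !ffunE (px_linear HQ).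
apply: (fdim_extension outlin (above_subspace HQ i sS)).
- apply: fdim_ext (fdim_socle i) => m; split=> [[em xm] | [[em Sm] om]].
    split; first by split=> // d; rewrite xm.
    by apply/ffunP => d; rewrite !ffunE.
  by split=> // d; move/ffunP/(_ d): om; rewrite !ffunE.
(* Surjectivity onto the kernel of [inn] is where injectivity of [Q] enters. *)
- apply: fdim_ext Zk => y; split=> [[Fy y0] | [m [em Sm] ->]].
    have FyT : fam src tgt pQ (fun _ => True) i y.
      by move=> d; move: (Fy d); case: ifP => // _ [].
    have [_ _ _ inj _] := Hq.
    have [m [em xm]] := injective_exact HQ FyT inj y0.
    exists m; last by apply/ffunP => d; rewrite ffunE xm.
    split=> // d; rewrite xm; move: (Fy d); case: ifP => _; first by case.
    by move=> ->.
  split=> [d|].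
    rewrite ffunE; case: ifP => di.
      by split; [exact: Sm | rewrite (pe_px HQ) eqxx].
    by rewrite -em (px_pe HQ) di.
  rewrite /inn; have [_ _ _ _ rel] := HQ; rewrite -[RHS](rel m).
  by apply: eq_bigr => a _; rewrite !ffunE.
Qed.

(** By [cartan_actE] the arrow sum plus w_i equals 2 v_i + w_i minus the Cartan pairing, which is
    v_i + (s_i . v)_i. *)
Lemma fdim_above_below_sref S i (v : 'I_n -> int) : is_submodule pQ S -> gdim pQ S v ->
  exists t b, [/\ fdim (above S i) t, fdim (below S i) b,
    (t + b)%:Z = v i + sref_dot w i v i, b%:Z <= v i & v i <= t%:Z].
Proof.
move=> sS /(gdim_fdimP HQ _ sS)[u uv].
have [t [b [At Bb E]]] := fdim_above_below i sS (fun j => (uv j).2).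
have [vi Si] := uv i.
exists t, b; split=> //.
- rewrite E sref_dotE eqxx (cartan_actE noloop) PoszD.
  have -> : \sum_(d : darr A | dsrc src tgt d == i) v (dtgt src tgt d)
    = (\sum_(d : darr A | dsrc src tgt d == i) u (dtgt src tgt d))%:Z.
    by rewrite -natz natr_sum; apply: eq_bigr => d _; rewrite natz (uv _).1.
  by ring.
- by rewrite vi lez_nat; apply: fdim_le Bb Si _ => m; apply: below_comp.
- by rewrite vi lez_nat; apply: fdim_le Si At _ => m; apply: comp_above.
Qed.

Lemma below_above S i m : is_submodule pQ S -> below S i m -> above S i m.
Proof. by move=> sS /(below_comp HQ sS)/(comp_above sS). Qed.

(* Since dim below + dim above = v_i + (s_i . v)_i, with S_i in between, the
   dimension (s_i . v)_i also lies in between. *)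
Lemma gdim_reflect S i (v : 'I_n -> int) : is_submodule pQ S -> gdim pQ S v ->
  exists2 S', is_submodule pQ S' & gdim pQ S' (sref_dot w i v).
Proof.
move=> sS Sv; have [t [b [At Bb E le_b le_t]]] := fdim_above_below_sref i sS Sv.
(* The value is t + b - v_i, which is at least b because v_i is at most t; so it is a natural
   number. *)
have [c cE] : exists c : nat, sref_dot w i v i = c%:Z.
  by exists (absz (sref_dot w i v i)); lia.
have [||C [Cc BC CA]] := fdim_between (c := c) Bb At.
- by move=> m; apply: below_above.
- lia.
exists (splice pQ S i C).
  exact: (splice_submodule HQ noloop sS (fdim_subspace Cc)).
apply: gdim_ext (gdim_splice HQ noloop sS Cc BC CA Sv) => j.
by case: eqVneq => [->|ji]; rewrite ?cE // /sref_dot (negbTE ji).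
Qed.

(* Reflecting down along [sigma] turns the orbit point into 0 and [wpair] into
   the pairing with omega_w, whose support is where the socle lives. *)
Lemma gdim_orbitD sigma (u : 'I_n -> int) S : is_submodule pQ S ->
  gdim pQ S (fun j => orbit sigma j + u j) ->
  wpair (orbit sigma) u <= 0 -> forall j, u j = 0.
Proof.
elim: sigma u S => [|i sigma IH] u S sS Su P j.
  have /(gdim_fdimP HQ _ sS)[v uv] := Su.
  have uE k : u k = (v k)%:Z by rewrite -(uv k).1 /= add0r.
  (* At the empty word the pairing is a sum of nonnegative terms, so being nonpositive it vanishes
     termwise. *)
  have wu k : (0 < w k)%N -> v k = 0%N.
    move=> wk; have : \sum_j (v j * w j)%N%:Z <= 0.
      suff <- : wpair (orbit [::]) u = \sum_j (v j * w j)%N%:Z by [].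
      by apply: eq_bigr => l _; rewrite /cartan_act big1 ?subr0 ?uE // => l' _; rewrite mulr0.
    have : 0 <= \sum_(j | j != k) (v j * w j)%N%:Z :> int by apply: sumr_ge0.
    rewrite [\sum_j _](bigD1 k) //=; set s := \sum_(j | _) _ => s0 H.
    have /eqP : (v k * w k = 0)%N by lia.
    by rewrite muln_eq0 (negbTE (lt0n_neq0 wk)) orbF => /eqP.
  (* A nonzero [S] would contain some nonzero [iota t], but [t] lives at vertices with [w k > 0],
     where [S] is zero. *)
  have S0 m : S m -> m = 0.
    move=> Sm; apply: NNPP => m0.
    have [t [St]] := essentialQ sS (ex_intro _ m (conj Sm m0)); apply.
    rewrite -iota0; congr iota; apply/ffunP => x; rewrite ffunE.
    pose k := (val x).1; have wk : (0 < w k)%N by apply: leq_ltn_trans (valP x).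
    have Ck : fdim (vcomp pQ S k) 0 by rewrite -(wu k wk); exact: (uv k).2.
    have [g [lg _ gC]] := Ck.
    have /gC[z] : vcomp pQ S k (pe pQ k (iota t)).
      by split; [case: sS => _ _ Se _; apply: Se | rewrite (pe_id HQ)].
    have -> : z = 0 by apply/rowP => -[].
    rewrite (is_linear0 lg) iota_pe -iota0 => /iota_inj/ffunP/(_ x).
    by rewrite !ffunE eqxx.
  have [uj Sj] := uv j; rewrite uE; congr Posz.
  apply: (fdim_uniq Sj); apply: fdim_ext (fdim_zero _) => m.
  split=> [->|[/S0]] //; split; last by rewrite (pe0 HQ).
  by case: sS.
have [S' sS' S'u] := gdim_reflect i sS Su.
have S'v : gdim pQ S' (fun j => orbit sigma j + sref_lin src tgt i u j).
  by apply: gdim_ext S'u => k; rewrite -(sref_dot_sref_dotD src tgt w).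
have H : sref_lin src tgt i u =1 (fun _ => 0).
  by apply: (IH _ S') => //; rewrite wpair_sref.
(* From s_i u = 0 to u = 0: off [i] the entries are unchanged, and at [i] the reflected entry is u_i
   - 2 u_i. *)
have u0 k : k != i -> u k = 0 by move=> ki; have := H k; rewrite /sref_lin (negbTE ki).
have [->|/u0 //] := eqVneq j i.
have := H i; rewrite /sref_lin eqxx.
have -> : cartan_act src tgt u i = 2 * u i.
  rewrite /cartan_act (bigD1 i) //= big1 ?addr0 ?cartan_diag // => k ki.
  by rewrite u0 ?mulr0.
lia.
Qed.

(* [splice S i (above S i)] is a submodule whose graded dimension exceeds the larger
   of the orbit points v and s_i . v by a multiple of alpha_i. *)
Lemma above_orbit sigma S i : is_submodule pQ S -> gdim pQ S (orbit sigma) ->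
  exists t b, [/\ fdim (above S i) t, fdim (below S i) b &
    (t%:Z = orbit sigma i /\ b%:Z = orbit (i :: sigma) i) \/
    (t%:Z = orbit (i :: sigma) i /\ b%:Z = orbit sigma i)].
Proof.
move=> sS Sv; have [t [b [At Bb E le_b le_t]]] := fdim_above_below_sref i sS Sv.
exists t, b; split=> //; set v := orbit sigma in Sv E le_b le_t *.
change (orbit (i :: sigma)) with (sref_dot w i v).
have BA m : below S i m -> above S i m by apply: below_above.
have sT := splice_submodule HQ noloop sS (fdim_subspace At) BA (fun _ => id).
have Tt := gdim_splice HQ noloop sS At BA (fun _ => id) Sv.
have sE := sref_dotE src tgt w i v i; rewrite eqxx in sE.
(* This sign decides which of v_i and (s_i . v)_i is larger. The excess of t over the larger one
   pairs nonpositively with that orbit point, so [gdim_orbitD] makes it zero. *)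
have [c_le0 | c_gt0] := lerP ((w i)%:Z - cartan_act src tgt v i) 0; [left | right].
  suff tv : t%:Z - v i = 0 by split; lia.
  pose u j := if j == i then t%:Z - v i else 0.
  have <- : u i = t%:Z - v i by rewrite /u eqxx.
  apply: (gdim_orbitD (sigma := sigma) sT).
    by apply: gdim_ext Tt => j; rewrite /u; case: eqVneq => [->|]; rewrite ?addr0 // addrC subrK.
  rewrite wpair_delta; apply: mulr_ge0_le0 => //; lia.
(* At s_i . v the pairing with alpha_i is the negative of the one at v, so the argument repeats
   there. *)
suff tv : t%:Z - sref_dot w i v i = 0 by split; lia.
pose u j := if j == i then t%:Z - sref_dot w i v i else 0.
have <- : u i = t%:Z - sref_dot w i v i by rewrite /u eqxx.
apply: (gdim_orbitD (sigma := i :: sigma) sT).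
  apply: gdim_ext Tt => j; rewrite /u /= -/v; case: eqVneq => [->|ji].
    by rewrite addrC subrK.
  by rewrite /sref_dot (negbTE ji) addr0.
rewrite wpair_delta /= -/v cartan_act_sref_dot cartan_diag.
apply: mulr_ge0_le0; lia.
Qed.

(** Induction on the word: the largest or the smallest modification of [S] at [i] has the dimension
    of the shorter word. The largest contains [S]; the smallest receives every arrow image of [S],
    which costs one more step of nilpotency. *)
Lemma gdim_orbit_nilp sigma S m : is_submodule pQ S -> gdim pQ S (orbit sigma) ->
  S m -> exists N, killed_by_paths pQ N m.
Proof.
elim: sigma S m => [|i sigma IH] S m sS Sv Sm.
  exists 0%N => -[] // _ /=.
  have /(gdim_fdimP HQ _ sS)[v uv] := Sv.
  rewrite -(sum_pe HQ m) big1 // => k _.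
  have [/= vk [g [lg _ gC]]] := uv k.
  have vk0 : v k = 0%N by case: (v k) vk.
  have /gC[z ->] : vcomp pQ S k (pe pQ k m).
    by split; [case: sS => _ _ Se _; apply: Se | rewrite (pe_id HQ)].
  suff -> : z = 0 by rewrite (is_linear0 lg).
  by apply/rowP => -[x xlt]; exfalso; rewrite vk0 in xlt.
have BA x : below S i x -> above S i x by apply: below_above.
have vE : forall j, orbit (i :: i :: sigma) j = orbit sigma j by apply: sref_dotK.
have spl c C : fdim C c -> c%:Z = orbit sigma i -> (forall x, below S i x -> C x) ->
    (forall x, C x -> above S i x) ->
    is_submodule pQ (splice pQ S i C) /\ gdim pQ (splice pQ S i C) (orbit sigma).
  move=> Cc cE BC CA; split; first exact: (splice_submodule HQ noloop sS (fdim_subspace Cc)).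
  apply: gdim_ext (gdim_splice HQ noloop sS Cc BC CA Sv) => j.
  case: eqVneq => [->|ji] //=.
  by rewrite /Defs.sref_dot (negbTE ji).
have [t [b [At Bb [[_ bE]|[tE _]]]]] := above_orbit i sS Sv; last first.
  rewrite vE in tE; have [sT Tv] := spl _ _ At tE BA (fun _ => id).
  by apply: IH sT Tv _; apply: (sub_splice HQ sS) => // x; apply: comp_above.
rewrite vE in bE; have [sT Tv] := spl _ _ Bb bE (fun _ => id) BA.
have xT d : splice pQ S i (below S i) (px pQ d m).
  have [S0 _ Se Sx] := sS.
  split=> [j _|]; first by apply/Se/Sx.
  rewrite (pe_px HQ); case: eqVneq => [<-|_]; first exact: (below_px HQ d sS Sm).
  by case: (fdim_subspace Bb).
have [f Hf] := fin_all_exists (fun d => IH _ _ sT Tv (xT d)).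
(* The maximum is uniform over the finitely many first arrows, and the successor counts that
   arrow. *)
exists (\max_d f d).+1; apply/killedS => d.
exact: (killed_le HQ (leq_bigmax d) (Hf d)).
Qed.

(** The vertices of [l] are treated one after the other, each time enlarging to [above]; by
    [above_orbit] the dimension stays in the orbit, and what was absorbed earlier is kept. *)
Lemma absorb_tops sigma S (l : seq 'I_n) : is_submodule pQ S -> gdim pQ S (orbit sigma) ->
  exists tau S', [/\ is_submodule pQ S', gdim pQ S' (orbit tau), (forall m, S m -> S' m) &
    forall i m, i \in l -> (forall d, S (px pQ d m)) -> S' (pe pQ i m)].
Proof.
move=> sS Sv; elim: l => [|i l [tau [S' [sS' S'v SS' S'l]]]].
  by exists sigma, S.
have BA m : below S' i m -> above S' i m by apply: below_above.
have [t [b [At Bb tb]]] := above_orbit i sS' S'v.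
have S'T m : S' m -> splice pQ S' i (above S' i) m.
  by apply: (sub_splice HQ sS') => x; apply: comp_above.
have Tt := gdim_splice HQ noloop sS' At BA (fun _ => id) S'v.
have [rho Tr] : exists rho, gdim pQ (splice pQ S' i (above S' i)) (orbit rho).
  case: tb => -[tE _]; [exists tau | exists (i :: tau)]; apply: gdim_ext Tt => j.
    by case: eqVneq => [->|].
  case: eqVneq => [->|ji] //=; by rewrite /Defs.sref_dot (negbTE ji).
exists rho, (splice pQ S' i (above S' i)); split=> //.
- exact: (splice_submodule HQ noloop sS' (fdim_subspace At)).
- by move=> m /SS'/S'T.
- move=> j m; rewrite inE => /orP[/eqP -> | jl] Sm; last exact/S'T/S'l.
  have [S'0 _ _ _] := sS'; split=> [k ki|].
    by rewrite (pe_pe HQ) (negbTE ki).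
  rewrite (pe_id HQ); split=> [|d]; first exact: (pe_id HQ).
  by rewrite (px_pe HQ); case: ifP => // _; exact: SS'.
Qed.

(** Arrows send an element killed by paths of length [N.+1] into the submodule found for [N];
    absorbing tops at all vertices captures its components, hence the element. *)
Lemma killed_in_orbit N : exists sigma S, [/\ is_submodule pQ S,
  gdim pQ S (orbit sigma) & forall m, killed_by_paths pQ N m -> S m].
Proof.
elim: N => [|N [sigma [S [sS Sv SN]]]].
  exists [::], (fun m => m = 0).
  have sub0 : is_submodule pQ (fun m => m = 0).
    split=> // [a u v -> -> | i m -> | d m ->]; first by rewrite scaler0 addr0.
      exact: pe0 HQ i.
    exact: px0 HQ d.
  split=> //; last by move=> m; apply: killed0.
  apply/(gdim_fdimP HQ _ sub0); exists (fun _ => 0%N) => i; split=> //.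
  apply: fdim_ext (fdim_zero Q) => m; split=> [->|[]] //.
  by split=> //; rewrite (pe0 HQ).
have [tau [S' [sS' S'v SS' S'e]]] := absorb_tops (enum 'I_n) sS Sv.
exists tau, S'; split=> // m /killedS kN.
apply: (submodule_pe HQ sS') => i; apply: S'e; first exact: mem_enum.
by move=> d; apply: SN.
Qed.

Lemma qtilde_loc_nilp m :
  qtilde src tgt pQ w m <-> exists N, killed_by_paths pQ N m.
Proof.
split=> [[sigma [S [sS Sv Sm]]] | [N kN]]; first exact: gdim_orbit_nilp Sv Sm.
by have [sigma [S [sS Sv SN]]] := killed_in_orbit N; exists sigma, S; split=> //; apply: SN.
Qed.

(** Elements of two different orbit submodules are added inside the locally nilpotent part. *)
Lemma qtilde_submodule : is_submodule pQ (qtilde src tgt pQ w).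
Proof.
have [L0 LD Le Lx] := loc_nilp_submodule HQ; split.
- exact/qtilde_loc_nilp.
- by move=> a u v /qtilde_loc_nilp Lu /qtilde_loc_nilp Lv; apply/qtilde_loc_nilp/LD.
- by move=> i m /qtilde_loc_nilp Lm; apply/qtilde_loc_nilp/Le.
- by move=> d m /qtilde_loc_nilp Lm; apply/qtilde_loc_nilp/Lx.
Qed.

End Hull.

Lemma killed_hom (K : fieldType) (n : nat) (A : finType) (M N : lmodType K)
  (pM : pmod_ops n A M) (pN : pmod_ops n A N) (f : M -> N) k m :
  is_hom pM pN f -> killed_by_paths pM k m -> killed_by_paths pN k (f m).
Proof.
move=> [lf _ fx] kM ds sz; rewrite -(is_linear0 lf) -(kM ds sz).
by elim: ds {sz} => //= d ds ->; rewrite fx.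
Qed.

Theorem mainTheorem12 (K : numClosedFieldType) (n : nat) (A : finType)
    (src tgt : A -> 'I_n) (noloop : forall a, src a != tgt a)
    (w : 'I_n -> nat)
    (Q : lmodType K) (pQ : pmod_ops n A Q) (HQ : is_pmod src tgt pQ)
    (iota : SW K w -> Q)
    (Hq : injective_hull_in (@catMod K n A src tgt) pQ (sw_ops K A w)
            (fun _ => True) iota) :
  exists j : SW K w -> Q,
    injective_hull_in (@catLn K n A src tgt) pQ (sw_ops K A w) (qtilde src tgt pQ w) j
    /\ loc_nilp_sub pQ (qtilde src tgt pQ w).
Proof.
have LP := qtilde_loc_nilp noloop HQ Hq.
exists iota; split; last by move=> m /LP.
have [_ ihom iinj inj ess] := Hq; split=> //.
- split; first exact: (qtilde_submodule noloop HQ Hq).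
  (* Length 1 suffices, since every arrow acts on s^w by 0. *)
  move=> t; apply/LP; exists 1%N; apply/killedS => d.
  by rewrite (iota_px Hq); exact: killed_zero HQ _.
(* The extension to q^w exists by injectivity among all modules; its image is locally nilpotent
   because [Y] is, so it lies in the union. *)
- move=> X Y pX pY f g [HX nX] [HY nY] fhom finj ghom _.
  have [h [hhom _ hf]] := inj X Y pX pY f g HX HY fhom finj ghom (fun _ => I).
  exists h; split=> // y; apply/LP; have [N kN] := nY y I.
  by exists N; apply: killed_hom hhom kN.
- by move=> U sU _; apply: ess.
Qed.
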